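(* Let $\mathcal{H}=(C,F,D,G)$ be a hybrid system on $\mathbb{R}^n$, and given an initial condition $x_0$, suppose that $\mathcal{H}$ is nominally inner and nominally outer well-posed at $x_0$ and pre-forward complete from $x_0$. Given a hybrid time $(T,J)\in\mathbb{R}_{\geq0}\times\mathbb{N}$, suppose that the reachable set $\mathcal{R}_{\mathcal{H}}(x_0,T,J)$ is nonempty. Consider a cost function $\mathcal{J}$ that is continuous at all $\xi'\in\{x_0\}\times\{(T,J)\}\times\mathbb{R}^n$, and let $$h(x_0',\varepsilon)=\mathcal{J}^*_{\mathcal{H}}\left(\{x_0'\}\times[\max\{0,T-\varepsilon\},T+\varepsilon]\times\{J\}\times\mathbb{R}^n\right)\qquad\forall x_0'\in\mathrm{cl}(C)\cup D,\ \varepsilon\geq0.$$ Then there exists a class-$\mathcal{K}$ function $\alpha$ such that $$\lim_{\substack{\varepsilon\to0,\ x_0'\to x_0\\ \varepsilon>0\\ x_0'\in(x_0+\alpha(\varepsilon)\mathbb{B})\cap(\mathrm{cl}(C)\cup D)}}h(x_0',\varepsilon)=h(x_0,0).$$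
   Context: $\mathbb{N}=\{0,1,2,\dots\}$; $\mathbb{B}$ is the closed unit ball. A class-$\mathcal{K}$ function is a continuous, strictly increasing function $\alpha:\mathbb{R}_{\geq0}\to\mathbb{R}_{\geq0}$ with $\alpha(0)=0$. A hybrid system $\mathcal{H}=(C,F,D,G)$ on $\mathbb{R}^n$ consists of sets $C,D\subset\mathbb{R}^n$ and set-valued maps $F,G:\mathbb{R}^n\rightrightarrows\mathbb{R}^n$ with $C\subset\mathrm{dom}\,F$, $D\subset\mathrm{dom}\,G$ (where $\mathrm{dom}$ of a set-valued map is the set where its values are nonempty), and represents $\dot x\in F(x)$ for $x\in C$, $x^+\in G(x)$ for $x\in D$. A set $E\subset\mathbb{R}_{\geq0}\times\mathbb{N}$ is a hybrid time domain if for every $(T,J)\in E$ there is a nondecreasing sequence $\{t_j\}_{j=0}^{J+1}$ with $t_0=0$ and $E\cap([0,T]\times\{0,\dots,J\})=\bigcup_{j=0}^{J}([t_j,t_{j+1}]\times\{j\})$. A hybrid arc is a function $x:\mathrm{dom}\,x\to\mathbb{R}^n$ such that $\mathrm{dom}\,x$ is a hybrid time domain and for each $j$, $t\mapsto x(t,j)$ is locally absolutely continuous on $I^j:=\{t:(t,j)\in\mathrm{dom}\,x\}$. It is a solution of $\mathcal{H}$ if $x(0,0)\in\mathrm{cl}(C)\cup D$; for each $j$, $x(t,j)\in C$ for all $t\in\mathrm{int}\,I^j$ and $\dot x(t,j)\in F(x(t,j))$ for almost all $t\in I^j$; and whenever $(t,j),(t,j+1)\in\mathrm{dom}\,x$,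 $x(t,j)\in D$ and $x(t,j+1)\in G(x(t,j))$. A solution originates from $x_0$ if $x(0,0)=x_0$. It is maximal if it cannot be extended to another solution, complete if its domain is unbounded, bounded if its range is bounded. It escapes to infinity at hybrid time $(T,J)$ if $|x(t,J)|\to\infty$ as $t$ tends to $T$ from the left. $\mathcal{S}_{\mathcal{H}}(x_0)$ is the set of maximal solutions originating from $x_0$; $\mathcal{H}$ is pre-forward complete from $x_0$ if every $x\in\mathcal{S}_{\mathcal{H}}(x_0)$ is bounded or complete. The reachable set is $\mathcal{R}_{\mathcal{H}}(x_0,T,J):=\{x(T,J):x\in\mathcal{S}_{\mathcal{H}}(x_0),\ (T,J)\in\mathrm{dom}\,x\}$, for $x_0\in\mathrm{cl}(C)\cup D$. If $\mathrm{dom}\,x$ is compact, its terminal hybrid time is the $(T,J)\in\mathrm{dom}\,x$ with $t\leq T$, $j\leq J$ for all $(t,j)\in\mathrm{dom}\,x$. $\widehat{\mathcal{S}}_{\mathcal{H}}$ is the set of all solutions of $\mathcal{H}$ (not necessarily maximal) with compact domain. A sequence $\{x_i\}$ of hybrid arcs is locally eventually bounded if for any $\tau\geq0$ there exist $i_0\geq 0$ and a compact set $K'$ such that $x_i(t,j)\in K'$ for all $i\geq i_0$ and $(t,j)\in\mathrm{dom}\,x_i$ with $t+j\leq\tau$. It converges graphically to a set-valued map $N:\mathbb{R}_{\geq0}\times\mathbb{N}\rightrightarrows\mathbb{R}^n$ (its graphical limit) if the graphs of $x_i$ converge to the graph of $N$ in the Painlevé–Kuratowski sense. $\mathcal{H}$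 is nominally outer well-posed at $x_0$ if for every graphically convergent sequence of solutions $\{x_i\}$ of $\mathcal{H}$ with $\lim_i x_i(0,0)=x_0$: (i) if $\{x_i\}$ is locally eventually bounded, the graphical limit is a solution of $\mathcal{H}$ originating from $x_0$; (ii) otherwise, there is $(T,J)\in\mathbb{R}_{\geq0}\times\mathbb{N}$ such that $x=N|_{\mathrm{dom}\,N\cap([0,T)\times\{0,\dots,J\})}$ is a solution of $\mathcal{H}$ originating from $x_0$ that escapes to infinity at hybrid time $(T,J)$, where $N$ is the graphical limit. $\mathcal{H}$ is nominally inner well-posed at $x_0$ if for every solution $x$ of $\mathcal{H}$ originating from $x_0$: given any sequence $\{\xi_i\}$ in $\mathrm{cl}(C)\cup D$ convergent to $x(0,0)$, for every $i$ there is a solution $x_i$ of $\mathcal{H}$ originating from $\xi_i$ such that (a) if $x$ is bounded or complete and $\mathrm{dom}\,x$ is closed, then $\{x_i\}$ is locally eventually bounded and graphically convergent to $x$; (b) if $x$ escapes to infinity at hybrid time $(T,J)$, then $\{x_i\}$ is not locally eventually bounded but is graphically convergent to a mapping $N$ with $x=N|_{\mathrm{dom}\,N\cap([0,T)\times\{0,\dots,J\})}$. A cost function is a function $\mathcal{J}:\mathbb{R}^n\times\mathbb{R}_{\geq0}\times\mathbb{N}\times\mathbb{R}^n\to\mathbb{R}_{\geq0}$. For $\Omega'\subset\mathbb{R}^n\times\mathbb{R}_{\geq0}\times\mathbb{N}\times\mathbb{R}^n$, $$\mathcal{J}^*_{\mathcal{H}}(\Omega'):=\inf\{\mathcal{J}(x(0,0),(T,J),x(T,J)):\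 x\in\widehat{\mathcal{S}}_{\mathcal{H}},\ (x(0,0),(T,J),x(T,J))\in\Omega'\},$$ where $(T,J)$ is the terminal hybrid time of $x$, with value $\infty$ if no such $x$ exists. *)

(* Defs.v *)
From HB Require Import structures.
From mathcomp Require Import all_boot all_order all_algebra.
From mathcomp Require Import all_classical all_reals all_analysis.

Set Implicit Arguments.
Unset Strict Implicit.
Unset Printing Implicit Defensive.

Import Order.TTheory GRing.Theory Num.Theory.
Import numFieldNormedType.Exports.

Local Open Scope classical_set_scope.
Local Open Scope ring_scope.

(* The library norm `|.| on 'rV[R]_n is the sup norm. It is used below only where
   equivalent norms give the same notion. *)
Definition enorm (R : realType) (n : nat) (v : 'rV[R]_n) : R :=
  Num.sqrt (\sum_(i < n) v 0 i ^+ 2).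

Definition class_K (R : realType) (alpha : R -> R) : Prop :=
  [/\ {within `[0, +oo[, continuous alpha},
      {in `[0, +oo[ &, {homo alpha : s t / s < t}} &
      alpha 0 = 0].

Definition smap_dom (S T : Type) (N : S -> set T) : set S :=
  [set s | N s !=set0].

Definition smap_graph (S T : Type) (N : S -> set T) : set (S * T) :=
  [set z | N z.1 z.2].

Definition smap_restrict (S T : Type) (N : S -> set T) (E : set S) :
    S -> set T :=
  fun s => [set v | E s /\ N s v].

Record hybrid_system (R : realType) (n : nat) := HybridSystem {
  flow_set : set 'rV[R]_n;
  flow_map : 'rV[R]_n -> set 'rV[R]_n;
  jump_set : set 'rV[R]_n;
  jump_map : 'rV[R]_n -> set 'rV[R]_n;
  flow_set_sub : flow_set `<=` smap_dom flow_map;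
  jump_set_sub : jump_set `<=` smap_dom jump_map }.

Definition init_set (R : realType) (n : nat) (H : hybrid_system R n) :
    set 'rV[R]_n :=
  closure (flow_set H) `|` jump_set H.

Definition hybrid_time_domain (R : realType) (E : set (R * nat)) : Prop :=
  (forall p, E p -> 0 <= p.1) /\
  forall (T : R) (J : nat), E (T, J) ->
    exists t : nat -> R,
      [/\ t 0%N = 0,
          forall j, (j <= J)%N -> t j <= t j.+1 &
          E `&` (`[0, T] `*` `I_J.+1) =
          \bigcup_(j in `I_J.+1) (`[t j, t j.+1] `*` [set j])].

(* A function defined on a subset of R * nat: arc_val is irrelevant outside
   arc_dom. *)
Record pre_arc (R : realType) (n : nat) := PreArc {
  arc_dom : set (R * nat);
  arc_val :> R * nat -> 'rV[R]_n }.

(* An arc seen as a set-valued map, empty-valued off its domain. *)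
Definition arc_smap (R : realType) (n : nat) (x : pre_arc R n) :
    R * nat -> set 'rV[R]_n :=
  fun p => [set v | arc_dom x p /\ v = x p].

Definition flow_interval (R : realType) (n : nat) (x : pre_arc R n) (j : nat) :
    set R :=
  [set t | arc_dom x (t, j)].

Definition abs_continuous_on (R : realType) (n : nat) (f : R -> 'rV[R]_n)
    (a b : R) : Prop :=
  forall e : R, 0 < e -> exists2 d : R, 0 < d &
    forall (k : nat) (u v : 'I_k -> R),
      (forall i, [/\ a <= u i, u i <= v i & v i <= b]) ->
      trivIset [set: 'I_k] (fun i => `]u i, v i[%classic) ->
      \sum_(i < k) (v i - u i) < d ->
      \sum_(i < k) `|f (v i) - f (u i)| < e.

Definition loc_abs_continuous_on (R : realType) (n : nat) (f : R -> 'rV[R]_n)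
    (I : set R) : Prop :=
  forall a b : R, a <= b -> `[a, b] `<=` I -> abs_continuous_on f a b.

Definition hybrid_arc (R : realType) (n : nat) (x : pre_arc R n) : Prop :=
  hybrid_time_domain (arc_dom x) /\
  forall j, loc_abs_continuous_on (fun t => x (t, j)) (flow_interval x j).

(* The derivative is two-sided, hence may depend on the values of arc_val off
   the domain, but only at the (at most two) endpoints of the interval I^j,
   which form a null set. *)
Definition solution (R : realType) (n : nat) (H : hybrid_system R n)
    (x : pre_arc R n) : Prop :=
  [/\ hybrid_arc x,
      arc_dom x (0, 0%N) /\ init_set H (x (0, 0%N)),
      forall j t, interior (flow_interval x j) t -> flow_set H (x (t, j)),
      forall j, {ae @lebesgue_measure R, forall t, flow_interval x j t ->
        derivable (fun s : R => x (s, j)) t 1 /\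
        flow_map H (x (t, j)) (derive1 (fun s : R => x (s, j)) t)} &
      forall t j, arc_dom x (t, j) -> arc_dom x (t, j.+1) ->
        jump_set H (x (t, j)) /\ jump_map H (x (t, j)) (x (t, j.+1))].

Definition solution_from (R : realType) (n : nat) (H : hybrid_system R n)
    (x0 : 'rV[R]_n) (x : pre_arc R n) : Prop :=
  solution H x /\ x (0, 0%N) = x0.

Definition arc_extends (R : realType) (n : nat) (y x : pre_arc R n) : Prop :=
  arc_dom x `<=` arc_dom y /\ forall p, arc_dom x p -> y p = x p.

Definition maximal_solution (R : realType) (n : nat) (H : hybrid_system R n)
    (x : pre_arc R n) : Prop :=
  solution H x /\
  ~ exists y, [/\ solution H y, arc_extends y x & arc_dom y <> arc_dom x].

Definition arc_complete (R : realType) (n : nat) (x : pre_arc R n) : Prop :=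
  ~ exists M : R, forall t j, arc_dom x (t, j) -> t <= M /\ j%:R <= M.

Definition arc_bounded (R : realType) (n : nat) (x : pre_arc R n) : Prop :=
  bounded_set (x @` arc_dom x).

(* The first conjunct makes the left limit meaningful: x(t, J) is defined for
   all t < T close to T. *)
Definition escapes_at (R : realType) (n : nat) (x : pre_arc R n) (T : R) (J : nat) :
    Prop :=
  (\forall t \near T^'-, arc_dom x (t, J)) /\
  enorm (x (t, J)) @[t --> T^'-] --> +oo.

Definition maximal_solutions_from (R : realType) (n : nat)
    (H : hybrid_system R n) (x0 : 'rV[R]_n) : set (pre_arc R n) :=
  [set x | maximal_solution H x /\ x (0, 0%N) = x0].

Definition pre_forward_complete_from (R : realType) (n : nat)
    (H : hybrid_system R n) (x0 : 'rV[R]_n) : Prop :=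
  forall x, maximal_solutions_from H x0 x -> arc_bounded x \/ arc_complete x.

Definition reachable_set (R : realType) (n : nat) (H : hybrid_system R n)
    (x0 : 'rV[R]_n) (T : R) (J : nat) : set 'rV[R]_n :=
  [set x (T, J) | x in
     [set x | maximal_solutions_from H x0 x /\ arc_dom x (T, J)]].

Definition terminal_time (R : realType) (n : nat) (x : pre_arc R n)
    (T : R) (J : nat) : Prop :=
  arc_dom x (T, J) /\
  forall t j, arc_dom x (t, j) -> t <= T /\ (j <= J)%N.

Definition compact_solutions (R : realType) (n : nat) (H : hybrid_system R n) :
    set (pre_arc R n) :=
  [set x | solution H x /\ compact (arc_dom x)].

Definition loc_eventually_bounded (R : realType) (n : nat)
    (x : nat -> pre_arc R n) : Prop :=
  forall tau : R, 0 <= tau ->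
    exists (i0 : nat) (K : set 'rV[R]_n), compact K /\
      forall i t j, (i0 <= i)%N -> arc_dom (x i) (t, j) -> t + j%:R <= tau ->
        K (x i (t, j)).

Definition inner_limit (T : topologicalType) (A : nat -> set T) : set T :=
  [set z | forall U, nbhs z U -> \forall i \near \oo, A i `&` U !=set0].

Definition outer_limit (T : topologicalType) (A : nat -> set T) : set T :=
  [set z | forall U, nbhs z U ->
     forall k, exists2 i, (k <= i)%N & A i `&` U !=set0].

Definition PK_converges (T : topologicalType) (A : nat -> set T) (L : set T) :
    Prop :=
  inner_limit A = L /\ outer_limit A = L.

Definition graph_converges (R : realType) (n : nat) (x : nat -> pre_arc R n)
    (N : R * nat -> set 'rV[R]_n) : Prop :=
  PK_converges (fun i => smap_graph (arc_smap (x i)) : set (R * nat * 'rV[R]_n))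
    (smap_graph N).

(* N|_{dom N `&` ([0,T) x {0,...,J})}; values off dom N are empty anyway. *)
Definition restrict_before (R : realType) (n : nat)
    (N : R * nat -> set 'rV[R]_n) (T : R) (J : nat) : R * nat -> set 'rV[R]_n :=
  smap_restrict N (smap_dom N `&` (`[0, T[ `*` `I_J.+1)).

Definition nominally_outer_well_posed (R : realType) (n : nat)
    (H : hybrid_system R n) (x0 : 'rV[R]_n) : Prop :=
  forall (x : nat -> pre_arc R n) (N : R * nat -> set 'rV[R]_n),
    (forall i, solution H (x i)) ->
    graph_converges x N ->
    x i (0, 0%N) @[i --> \oo] --> x0 ->
    (loc_eventually_bounded x ->
       exists2 y, solution_from H x0 y & arc_smap y = N) /\
    (~ loc_eventually_bounded x ->
       exists (T : R) (J : nat), 0 <= T /\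
         exists y, [/\ solution_from H x0 y,
                       arc_smap y = restrict_before N T J &
                       escapes_at y T J]).

Definition nominally_inner_well_posed (R : realType) (n : nat)
    (H : hybrid_system R n) (x0 : 'rV[R]_n) : Prop :=
  forall x : pre_arc R n, solution_from H x0 x ->
  forall xi : nat -> 'rV[R]_n,
    (forall i, init_set H (xi i)) ->
    xi i @[i --> \oo] --> x (0, 0%N) ->
    exists y : nat -> pre_arc R n,
      [/\ forall i, solution_from H (xi i) (y i),
          (arc_bounded x \/ arc_complete x) /\ closed (arc_dom x) ->
            loc_eventually_bounded y /\ graph_converges y (arc_smap x) &
          forall (T : R) (J : nat), 0 <= T -> escapes_at x T J ->
            ~ loc_eventually_bounded y /\
            exists2 N, graph_converges y N & arc_smap x = restrict_before N T J].

(* Functions on R^n x R>=0 x N x R^n are represented by functions on cost_arg, only their values at points with nonnegative time being relevant. *)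
Notation cost_arg R n := ('rV[R]_n * (R * nat) * 'rV[R]_n)%type.

Definition cost_domain (R : realType) (n : nat) :
    set (cost_arg R n) :=
  [set z | 0 <= z.1.2.1].

Definition cost_function (R : realType) (n : nat) (c : cost_arg R n -> R) :
    Prop :=
  forall z, cost_domain z -> 0 <= c z.

Definition cost_continuous_at (R : realType) (n : nat) (c : cost_arg R n -> R)
    (z : cost_arg R n) : Prop :=
  c y @[y --> within (@cost_domain R n) (nbhs z)] --> c z.

(* The infimum is taken in the extended reals, so it is +oo when no solution
   qualifies. *)
Definition optimal_cost (R : realType) (n : nat) (H : hybrid_system R n)
    (c : cost_arg R n -> R) (Omega : set (cost_arg R n)) : \bar R :=
  ereal_inf [set r | exists (x : pre_arc R n) (T : R) (J : nat),
    [/\ compact_solutions H x, terminal_time x T J,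
        Omega (x (0, 0%N), (T, J), x (T, J)) &
        r = (c (x (0, 0%N), (T, J), x (T, J)))%:E]].

Definition perturbed_cost (R : realType) (n : nat) (H : hybrid_system R n)
    (c : cost_arg R n -> R) (T : R) (J : nat) (x0' : 'rV[R]_n) (eps : R) :
    \bar R :=
  optimal_cost H c
    ([set x0'] `*` (`[Num.max 0 (T - eps), T + eps] `*` [set J]) `*` setT).

(* Main.v *)
Require Import Defs.
From HB Require Import structures.
From mathcomp Require Import all_boot all_order all_algebra.
From mathcomp Require Import all_classical all_reals all_analysis.
From mathcomp Require Import lra.
Import Order.TTheory GRing.Theory Num.Theory.
Import numFieldNormedType.Exports.
Local Open Scope classical_set_scope.
Local Open Scope ring_scope.

(** The perturbed cost is squeezed between two one-sided estimates at
    [(x0, 0)], of which only the upper one restricts how [x0'] and [eps]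
    approach their limits.

    Lower semicontinuity ([perturbed_cost_lower]) is a compactness argument.
    From solutions starting near [x0], ending near [(T, J)] and costing less
    than the limit value by a fixed amount one extracts a graphically
    convergent sequence ([PK_convergent_subsequence]). Outer well-posedness
    makes the limit a solution from [x0], unless it yields a solution from
    [x0] that escapes to infinity in finite time, and this is excluded by
    pre-forward completeness together with inner well-posedness
    ([no_escape]). The limit passes through [(T, J)], and continuity of the
    cost makes it cheaper than the infimum.

    Upper semicontinuity ([perturbed_cost_upper]) is a perturbation argument:
    a nearly optimal solution from [x0] is, by inner well-posedness, the
    graphical limit of solutions from nearby states. Graphical convergence
    lets them reach the state near [x (T, J)] at some nearby time, not
    necessarily at [T], so a tolerance [eps > 0] is needed, and for a given [eps]
    only states [x0'] within some radius depending on [eps] are covered. The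
    class-K function [alpha] is a continuous strictly increasing minorant of
    that radius ([class_K_avoiding]).

    Both arguments use that a solution passing through [(T, J)] can be
    truncated there to one with compact domain and terminal time [(T, J)]
    ([optimal_cost_le]). *)

(** * Extraction of graphically convergent subsequences *)

(** Along a free ultrafilter every property holds or fails with a definite
    value [l i], and finitely many of these verdicts are reached
    simultaneously at arbitrarily late indices; so no nested extraction of
    subsequences is required. *)
Lemma diagonal_subsequence {I : countType} (b : nat -> I -> Prop) :
  exists (phi : nat -> nat) (l : I -> Prop), (forall m, (m <= phi m)%N) /\
    forall i, \forall m \near \oo, b (phi m) i <-> l i.
Proof.
have [G [UG sG]] := ultraFilterLemma (eventually_filter).
have FG := @ultra_proper _ _ UG.
pose l i := G [set m | b m i].
have agree i : G [set m | b m i <-> l i].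
  have [Gb|Gnb] := in_ultra_setVsetC [set m | b m i] UG.
    by apply: filterS (Gb) => m /= bm; split.
  apply: filterS (Gnb) => m /= nbm; split=> [/nbm //|li]; exfalso.
  have : G set0; last by move/filter_ex => [? []].
  by apply: filterS (filterI Gnb li) => k [].
have agree_lt m : G [set k | forall i, (pickle i < m)%N -> b k i <-> l i].
  elim: m => [|m IH]; first by apply: filterE.
  case: (pselect (exists i : I, pickle i = m)) => [[i im]|nex].
    apply: filterS (filterI IH (agree i)) => k /= [IHk ki] j.
    rewrite ltnS leq_eqVlt => /orP[/eqP jm|]; last exact: IHk.
    by have -> : j = i by apply: (pcan_inj pickleK); rewrite jm im.
  apply: filterS IH => k /= IHk j.
  rewrite ltnS leq_eqVlt => /orP[/eqP jm|]; last exact: IHk.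
  by exfalso; apply: nex; exists j.
have pick m : exists k, (m <= k)%N /\
    forall i, (pickle i < m)%N -> b k i <-> l i.
  have Gm : G [set k | (m <= k)%N] by apply: sG; exists m.
  by have [k [? ?]] := filter_ex (filterI Gm (agree_lt m)); exists k.
have [phi phiP] := choice pick.
exists phi, l; split=> [m|i]; first by case: (phiP m).
by exists (pickle i).+1 => // m /= im; case: (phiP m) => _; apply.
Qed.

(** Sequential compactness of Painleve-Kuratowski convergence. Once each
    member of a countable base is eventually hit or eventually missed by the
    sets [A (phi m)], being met frequently and being met eventually coincide,
    so that the outer limit is contained in the inner one. *)
Lemma PK_convergent_subsequence {X : topologicalType} {I : countType}
    (B : I -> set X)
    (hB : forall (z : X) (V : set X), nbhs z V -> exists2 i, nbhs z (B i) & B i `<=` V)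
    (A : nat -> set X) :
  exists (phi : nat -> nat) (L : set X), (forall m, (m <= phi m)%N) /\
    PK_converges (fun m => A (phi m)) L.
Proof.
have [phi [l [phi_ge phil]]] :=
  diagonal_subsequence (fun m i => A m `&` B i !=set0).
exists phi, (outer_limit (fun m => A (phi m))); split=> //; split=> //.
rewrite eqEsubset; split=> z /= hz U zU.
  move=> k; have [N _ hN] := hz U zU.
  exists (maxn k N); first exact: leq_maxl.
  by apply: hN; rewrite /= leq_maxr.
have [i zBi BiU] := hB z U zU.
have [N _ hN] := phil i.
have [m Nm mB] := hz _ zBi N.
have li : l i by apply/(hN m Nm).
exists N => // k /= Nk.
have /(hN k Nk) [w [Aw Bw]] := li.
by exists w; split=> //; exact: BiU.
Qed.

(** The space of graphs of hybrid arcs is second countable: balls with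
    rational centres and radii [1 / (m + 1)] suffice. *)
Lemma rational_nbhs_base {R : realType} {n : nat} :
  exists B : rat * nat * 'rV[rat]_n * nat -> set (R * nat * 'rV[R]_n),
    forall (z : R * nat * 'rV[R]_n) (V : set (R * nat * 'rV[R]_n)), nbhs z V ->
      exists2 i, nbhs z (B i) & B i `<=` V.
Proof.
pose ctr (i : rat * nat * 'rV[rat]_n * nat) : R * nat * 'rV[R]_n :=
  (ratr i.1.1.1, i.1.1.2, map_mx (@ratr R) i.1.2).
exists (fun i => ball (ctr i) (i.2.+1%:R^-1 : R)).
move=> z V /nbhs_ballP[/= e e0 zeV].
have [m me] : exists m : nat, m.+1%:R^-1 < e / 2.
  have := @near_infty_natSinv_lt R (PosNum (divr_gt0 e0 (ltr0n R 2))).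
  by move=> [m _ /(_ m (leqnn m))] /= ?; exists m.
set r : R := m.+1%:R^-1 in me.
have r0 : 0 < r by rewrite invr_gt0.
have approx (t : R) : exists q : rat, `|t - ratr q| < r / 2.
  have [q /=] := @rat_in_itvoo R (t - r / 2) (t + r / 2) ltac:(lra).
  rewrite in_itv /= => /andP[? ?]; exists q.
  by rewrite ltr_norml; apply/andP; split; lra.
have [q qP] := choice approx.
pose i := (q z.1.1, z.1.2, (\row_j q (z.2 0 j)), m).
have iz : ball (ctr i) (r / 2) z.
  split=> [/=|/=]; first split=> /=.
  - by rewrite /ball /= distrC; exact: qP.
  - by apply: ballxx; rewrite divr_gt0.
  - split=> [|a j]; first by rewrite divr_gt0.
    by rewrite !mxE (ord1 a) /ball /= distrC; exact: qP.
exists i => [|w iw].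
  have r20 : 0 < r / 2 by rewrite divr_gt0.
  apply: filterS (nbhsx_ballx z (r / 2) r20) => w zw.
  by rewrite -/r (splitr r); exact: ball_triangle iz zw.
apply: zeV.
have : ball z (r / 2 + r) w by apply: ball_triangle iw; exact: ball_sym.
by apply: le_ball; lra.
Qed.

(** * Class-K functions and the Euclidean norm *)

(** If the points [(d, s)] of a bad region stay at a positive distance [d]
    whenever [s] is bounded away from [0], then the graph of some class-K
    function lies strictly below that region. The infimal convolution
    [beta e], the infimum over bad [(d, s)] of [d + max (e - s) 0], is
    nondecreasing, 1-Lipschitz, positive for [e > 0], and at most [d] at
    [e = s]. Multiplying it by [e] makes it strictly increasing and
    decreases it strictly on [0 < e < 1]. *)
Lemma class_K_avoiding {R : realType} {B : R -> R -> Prop}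
    (Bge0 : forall d s, B d s -> 0 <= d)
    (Bfar : forall e, 0 < e -> exists2 r, 0 < r &
      forall d s, e <= s -> B d s -> r <= d) :
  exists2 alpha : R -> R, class_K alpha &
    forall d s, 0 < s -> s < 1 -> B d s -> alpha s < d.
Proof.
(* The extra member [e] keeps the infimum meaningful when nothing is bad. *)
pose S e : set R :=
  [set w | w = e \/ exists d s, B d s /\ w = d + Num.max (e - s) 0].
pose beta e := inf (S e).
have Slb e : has_lbound (S e).
  exists (Num.min e 0) => w [->|[d [s [/Bge0 d0 ->]]]].
    by rewrite ge_min lexx.
  by rewrite ge_min addr_ge0 ?orbT // le_max lexx orbT.
have SN0 e : S e !=set0 by exists e; left.
have beta_le e w : S e w -> beta e <= w by move=> Sw; exact: ge_inf.
have le_beta e b : (forall w, S e w -> b <= w) -> b <= beta e.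
  by move=> h; exact: lb_le_inf.
have beta_id e : beta e <= e by apply: beta_le; left.
have beta_B e d s : B d s -> beta e <= d + Num.max (e - s) 0.
  by move=> Bds; apply: beta_le; right; exists d, s.
have beta_mono e1 e2 : e1 <= e2 -> beta e1 <= beta e2.
  move=> e12; apply: le_beta => w [->|[d [s [Bds ->]]]].
    exact: le_trans e12.
  apply: le_trans (beta_B e1 _ _ Bds) _; rewrite lerD2l.
  by rewrite ge_max !le_max lexx lerD2r e12 orbT.
have beta_lip e1 e2 : e1 <= e2 -> beta e2 <= beta e1 + (e2 - e1).
  move=> e12; rewrite -lerBlDr; apply: le_beta => w [->|[d [s [Bds ->]]]].
    by have := beta_id e2; lra.
  have := beta_B e2 _ _ Bds.
  by case: (leP (e2 - s) 0); case: (leP (e1 - s) 0); lra.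
have beta_gt0 e : 0 < e -> 0 < beta e.
  move=> e0; have [r r0 hr] := Bfar (e / 2) ltac:(lra).
  apply: (@lt_le_trans _ _ (Num.min r (e / 2))).
    by rewrite lt_min r0 divr_gt0.
  apply: le_beta => w [->|[d [s [Bds ->]]]].
    by rewrite ge_min; apply/orP; right; lra.
  rewrite ge_min; apply/orP; have [es|se] := leP (e / 2) s.
    by left; rewrite (le_trans (hr d s es Bds)) // lerDl le_max lexx orbT.
  right; have := Bge0 _ _ Bds; case: (leP (e - s) 0); lra.
have beta_cont : continuous beta.
  move=> e; apply/cvgrPdist_le => d d0; near=> t.
  have : `|e - t| <= d by near: t; exact: cvgr_dist_le.
  rewrite !ler_norml => /andP[? ?].
  have [et|/ltW te] := leP e t.
    by have := beta_mono _ _ et; have := beta_lip _ _ et; lra.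
  by have := beta_mono _ _ te; have := beta_lip _ _ te; lra.
exists (fun e => beta e * e).
  split; last by rewrite mulr0.
    apply: continuous_subspaceT => e; apply: cvgM; first exact: beta_cont.
    exact: cvg_id.
  move=> s t; rewrite !in_itv /= !andbT => s0 t0 st.
  have [->|s_neq0] := eqVneq s 0.
    by rewrite mulr0 mulr_gt0 ?beta_gt0 // (le_lt_trans s0).
  have t_gt0 := le_lt_trans s0 st.
  apply: (@le_lt_trans _ _ (beta t * s)); last by rewrite ltr_pM2l ?beta_gt0.
  by rewrite ler_wpM2r // beta_mono // ltW.
move=> d s s0 s1 Bds; apply: (@lt_le_trans _ _ (beta s)).
  by rewrite gtr_pMr ?beta_gt0.
by have := beta_B s _ _ Bds; rewrite subrr maxxx addr0.
Unshelve. all: by end_near. Qed.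

Lemma norm_le_enorm {R : realType} {n : nat} (v : 'rV[R]_n) : `|v| <= enorm v.
Proof.
rewrite /Num.norm /= mx_normrE; apply/bigmax_leP; split=> [|[i j] _ /=].
  exact: sqrtr_ge0.
rewrite (ord1 i) -sqrtr_sqr ler_sqrt; last first.
  by apply: sumr_ge0 => k _; exact: sqr_ge0.
rewrite (bigD1 j) //= lerDl; apply: sumr_ge0 => k _; exact: sqr_ge0.
Qed.

Lemma enorm_le_norm {R : realType} {n : nat} (v : 'rV[R]_n) :
  enorm v <= n%:R * `|v|.
Proof.
have v0 : 0 <= n%:R * `|v| by rewrite mulr_ge0 ?ler0n.
rewrite -(ger0_norm v0) -sqrtr_sqr ler_sqrt ?sqr_ge0 //.
rewrite exprMn; apply: (@le_trans _ _ (\sum_(i < n) `|v| ^+ 2)).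
  apply: ler_sum => i _; rewrite -(real_normK (num_real (v 0 i))).
  rewrite ler_sqr ?nnegrE // [leRHS]/Num.norm /= mx_normrE.
  by apply/bigmax_geP; right; exists (0, i).
rewrite sumr_const card_ord -[leLHS]mulr_natl ler_wpM2r ?sqr_ge0 //.
by rewrite -natrX ler_nat; case: (n) => // k; rewrite leq_pmulr.
Qed.

(** * Truncation of solutions *)

Lemma abs_continuous_on_continuous {R : realType} {n : nat} {f : R -> 'rV[R]_n}
    {a b : R} :
  abs_continuous_on f a b -> {within `[a, b], continuous f}.
Proof.
move=> acf; apply/subspace_continuousP => s /=; rewrite in_itv /= => /andP[sa sb].
apply/cvgrPdist_lt => e e0; have [d d0 acd] := acf e e0.
near=> t.
have : t \in `[a, b] by near: t; exact: withinT.
rewrite in_itv /= => /andP[ta tb].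
have std : `|s - t| < d.
  by near: t; apply: cvg_within; exact: (@cvgr_dist_lt _ _ _ _ _ id s cvg_id).
have small u v : a <= u -> u <= v -> v <= b -> v - u < d -> `|f v - f u| < e.
  move=> au uv vb vud; have := acd 1%N (fun=> u) (fun=> v).
  rewrite !big_ord1; apply=> //.
  by move=> i j _ _ _; rewrite (ord1 i) (ord1 j).
move: std; rewrite ltr_norml => /andP[? ?].
by have [st|/ltW ts] := leP s t; [rewrite distrC|]; apply: small => //; lra.
Unshelve. all: by end_near. Qed.

Section Truncation.
Context {R : realType} {n : nat}.
Implicit Types (H : hybrid_system R n) (x : pre_arc R n).

Definition truncate x (T : R) (J : nat) : pre_arc R n :=
  PreArc (arc_dom x `&` (`[0, T] `*` `I_J.+1)) x.

Lemma hybrid_time_domain_truncate {E : set (R * nat)} {T : R} {J : nat} :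
  hybrid_time_domain E ->
  hybrid_time_domain (E `&` (`[0, T] `*` `I_J.+1)).
Proof.
move=> [Ege0 Edec]; split=> [p [/Ege0 //]|T' J' [ET' [/= T'T J'J]]].
have [t [t0 tmono tE]] := Edec _ _ ET'.
exists t; split=> //; rewrite -tE -setIA; congr (_ `&` _).
rewrite eqEsubset; split=> [p [] //|[s j] [/= sT' jJ']].
move: T'T sT'; rewrite !in_itv /= => /andP[_ T'T] /andP[s0 sT'].
split; split=> //=; rewrite ?in_itv /= ?s0 //; first exact: le_trans T'T.
exact: leq_ltn_trans J'J.
Qed.

Lemma truncate_terminal {x} {T : R} {J : nat} :
  0 <= T -> arc_dom x (T, J) -> terminal_time (truncate x T J) T J.
Proof.
move=> T0 xT; split.
  by split=> //; split=> /=; rewrite ?in_itv /= ?T0 ?lexx ?leqnn.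
by move=> t j [_ [/=]]; rewrite in_itv /= ltnS => /andP[].
Qed.

Lemma truncate_compact {x} {T : R} {J : nat} :
  hybrid_time_domain (arc_dom x) -> arc_dom x (T, J) ->
  compact (arc_dom (truncate x T J)).
Proof.
move=> [_ xdec] /xdec[t [_ _ /= ->]].
rewrite bigcup_mkord; apply: bigsetU_compact => j _.
by apply: compact_setX; [exact: segment_compact | exact: compact_set1].
Qed.

Lemma truncate_solution {H x} {T : R} {J : nat} :
  0 <= T -> solution H x -> solution H (truncate x T J).
Proof.
move=> T0 [[xdom xac] [x00 xinit] xflow xae xjump]; split.
- split=> [|j a b ab sub]; first exact: hybrid_time_domain_truncate.
  by apply: xac => // s /sub[].
- by split=> //; split=> //; split=> //=; rewrite in_itv /= lexx T0.
- by move=> j t xt; apply: xflow; apply: interiorS xt => s [].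
- move=> j; apply: negligibleS (xae j) => t /= nP P.
  by apply: nP => -[xt _]; exact: P.
- by move=> t j [xt _] [xt1 _]; exact: xjump.
Qed.

(** The optimal cost may be bounded by any solution passing through the hybrid
    time [(T, J)], since its restriction to [[0, T] x {0, ..., J}] has compact
    domain and terminal time [(T, J)]. *)
Lemma optimal_cost_le {H x} {T : R} {J : nat} {c : cost_arg R n -> R}
    {Omega : set (cost_arg R n)} :
  solution H x -> arc_dom x (T, J) -> Omega (x (0, 0%N), (T, J), x (T, J)) ->
  (optimal_cost H c Omega <= (c (x (0, 0%N), (T, J), x (T, J)))%:E)%E.
Proof.
move=> solx xT xO; have [[xdom _] _ _ _ _] := solx.
have T0 : 0 <= T by case: xdom => /(_ _ xT).
apply: ereal_inf_lbound; exists (truncate x T J), T, J; split=> //.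
  by split; [exact: truncate_solution | exact: truncate_compact].
exact: truncate_terminal.
Qed.

(** The domain is a finite union of segments, on each of which the arc is
    continuous. *)
Lemma compact_arc_bounded {x} {T : R} {J : nat} :
  hybrid_arc x -> terminal_time x T J -> arc_bounded x.
Proof.
move=> [[xge0 xdec] xac] [xT xterm].
have [t [_ tmono tE]] := xdec _ _ xT.
have piece j : exists M : R, (j <= J)%N ->
    forall s, t j <= s -> s <= t j.+1 -> `|x (s, j)| <= M.
  have [jJ|] := leqP j J; last by exists 0.
  have sub : `[t j, t j.+1] `<=` flow_interval x j.
    move=> s sj; have : (arc_dom x `&` (`[0, T] `*` `I_J.+1)) (s, j).
      by rewrite tE; exists j.
    by case.
  have := continuous_compact (abs_continuous_on_continuous
    (xac j _ _ (tmono j jJ) sub)) (@segment_compact _ _ _).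
  move=> /compact_bounded[M [_ hM]]; exists (M + 1) => _ s ts st.
  apply: (hM (M + 1)); first by rewrite ltrDl.
  by exists s => //=; rewrite in_itv /= ts.
have [M hM] := choice piece.
exists (\sum_(j < J.+1) `|M j|); split; first exact: num_real.
move=> B /ltW MB _ [[s j] xs <-]; apply: le_trans MB.
have [sT jJ] := xterm _ _ xs.
have : (\bigcup_(j in `I_J.+1) (`[t j, t j.+1] `*` [set j])) (s, j).
  rewrite -tE; split=> //; split=> //=; rewrite in_itv /= sT.
  by rewrite (xge0 _ xs).
move=> [i /= iJ [/=]]; rewrite in_itv /= => /andP[ts st] ji; subst i.
rewrite (bigD1 (Ordinal iJ)) //= (le_trans (hM j jJ s ts st)) //.
rewrite (le_trans (ler_norm _)) // lerDl.
by apply: sumr_ge0.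
Qed.

End Truncation.

(** * Finite-time escape is impossible *)

(** Below a point [(T, J)] of the smaller domain nothing can be added to a
    hybrid time domain: both domains decompose there as
    [[t_j, t_j+1] x {j}], [j <= J], both decompositions cover [0, T], and
    nestedness of the segments then forces the jump times to agree. *)
Lemma hybrid_time_domain_rigid {R : realType} {E F : set (R * nat)} {T : R}
    {J : nat} :
  hybrid_time_domain E -> hybrid_time_domain F -> E `<=` F -> E (T, J) ->
  F `&` (`[0, T] `*` `I_J.+1) `<=` E.
Proof.
move=> [Ege0 Edec] [_ Fdec] EF ETJ; have T0 : 0 <= T := Ege0 _ ETJ.
have [s [s0 smono sE]] := Edec _ _ ETJ.
have [t [t0 tmono tF]] := Fdec _ _ (EF _ ETJ).
have inE j r : (j <= J)%N -> s j <= r -> r <= s j.+1 ->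
    (E `&` (`[0, T] `*` `I_J.+1)) (r, j).
  by move=> jJ sr rs; rewrite sE; exists j => //=; rewrite in_itv /= sr.
have nested j r : (j <= J)%N -> s j <= r -> r <= s j.+1 ->
    t j <= r /\ r <= t j.+1.
  move=> jJ sr rs; have [Er rectr] := inE j r jJ sr rs.
  have : (F `&` (`[0, T] `*` `I_J.+1)) (r, j) by split=> //; exact: EF.
  rewrite tF => -[i /= _ [/=]]; rewrite in_itv /= => /andP[? ?] ->.
  by split.
have st j : (j <= J)%N -> s j = t j.
  case: j => [|j] jJ; first by rewrite s0 t0.
  apply/eqP; rewrite eq_le; apply/andP; split.
    by have [] := nested j (s j.+1) (ltnW jJ) (smono j (ltnW jJ)) (lexx _).
  by have [] := nested j.+1 (s j.+1) jJ (lexx _) (smono _ jJ).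
have sT : s J.+1 = T.
  apply/eqP; rewrite eq_le; apply/andP; split.
    have [_ [/=]] := inE J (s J.+1) (leqnn J) (smono J (leqnn J)) (lexx _).
    by rewrite in_itv /= => /andP[].
  have : (E `&` (`[0, T] `*` `I_J.+1)) (T, J).
    by split=> //; split=> //=; rewrite in_itv /= T0 lexx.
  by rewrite sE => -[i /= _ [/=]]; rewrite in_itv /= => /andP[_ ?] ->.
move=> [r j] Frj; have := Frj; rewrite tF => -[i /= iJ [/=]].
rewrite in_itv /= => /andP[tr rt] ji; subst i.
suff rs : r <= s j.+1 by have [] := inE j r iJ _ rs; rewrite ?st.
move: iJ; rewrite ltnS leq_eqVlt => /orP[/eqP ->|jJ]; last by rewrite st.
rewrite sT; case: Frj => _ [/=]; rewrite in_itv /= => /andP[_ rT] _.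
exact: rT.
Qed.

Section Escape.
Context {R : realType} {n : nat}.
Implicit Types (H : hybrid_system R n) (x y z : pre_arc R n).

Lemma escaping_arc_unbounded {y} {T : R} {J : nat} :
  escapes_at y T J -> ~ arc_bounded y.
Proof.
move=> [ydom yinf] [M [_ hM]].
near T^'- => t.
have yt : arc_dom y (t, J) by near: t.
have : n%:R * (M + 1) < enorm (y (t, J)).
  by near: t; exact: yinf _ (nbhs_pinfty_gt (num_real _)).
rewrite ltNge => /negP; apply; apply: le_trans (enorm_le_norm _) _.
rewrite ler_wpM2l //; apply: (hM (M + 1)); first by rewrite ltrDl.
by exists (t, J).
Unshelve. all: by end_near. Qed.

(** Hybrid time domains need not be totally ordered: for instance
    [[0, 1] x {0}] together with the point [(0, 1)] is one. Hence an escaping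
    arc could have a second branch that jumps indefinitely, which would make
    it complete. Inner well-posedness, applied to the constant sequence of
    initial points, rules this out, because it identifies the arc with the
    restriction of a graphical limit to hybrid times before [(T, J)]. *)
Lemma escaping_solution_dom {H} {x0 : 'rV[R]_n} {z} {T : R} {J : nat} :
  nominally_inner_well_posed H x0 -> solution_from H x0 z -> 0 <= T ->
  escapes_at z T J -> arc_dom z `<=` `[0, T[ `*` `I_J.+1.
Proof.
move=> hinner solz T0 escz p zp.
have [[_ [_ zinit] _ _ _] z0] := solz.
have [w [_ _ /(_ T J T0 escz)[_ [N _ zN]]]] :=
  hinner z solz (fun=> z (0, 0%N)) (fun=> zinit) (cvg_cst _).
have : arc_smap z p (z p) by split.
by rewrite zN => -[[]].
Qed.

(** An extension [z] of an escaping solution [y] escapes at the same hybrid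
    time, so its domain lies before [(T, J)]; there [y] has points [(t, J)]
    with [t] arbitrarily close to [T], below which [z] adds nothing. *)
Lemma escaping_solution_maximal {H} {x0 : 'rV[R]_n} {y} {T : R} {J : nat} :
  nominally_inner_well_posed H x0 -> solution_from H x0 y -> 0 <= T ->
  escapes_at y T J -> maximal_solution H y.
Proof.
move=> hinner [soly y0] T0 escy; split=> // -[z [solz [yz zy] domzy]].
apply: domzy; rewrite eqEsubset; split=> // -[r j] zr.
have [ydom yinf] := escy.
have escz : escapes_at z T J.
  split; first by apply: filterS ydom => t; exact: yz.
  apply: cvg_trans yinf; apply: near_eq_cvg.
  by apply: filterS ydom => t yt; rewrite zy.
have [[y00 _] [z00 _]] : (arc_dom y (0, 0%N) /\ init_set H (y (0, 0%N))) /\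
    (arc_dom z (0, 0%N) /\ init_set H (z (0, 0%N))).
  by case: soly => _ ? _ _ _; case: solz.
have solz0 : solution_from H x0 z by split=> //; rewrite zy.
have [/=] := escaping_solution_dom hinner solz0 T0 escz _ zr.
rewrite in_itv /= => /andP[r0 rT] jJ.
near T^'- => t.
have yt : arc_dom y (t, J) by near: t.
have rt : r < t by near: t; exact: nbhs_left_gt.
have [[[domy _] _ _ _ _] [[domz _] _ _ _ _]] := (soly, solz).
apply: (hybrid_time_domain_rigid domy domz yz yt); split=> //.
by split=> //=; rewrite in_itv /= r0 ltW.
Unshelve. all: by end_near. Qed.

(** An escaping solution is maximal, unbounded, and has bounded domain,
    which contradicts pre-forward completeness. *)
Lemma no_escape {H} {x0 : 'rV[R]_n} {y} {T : R} {J : nat} :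
  nominally_inner_well_posed H x0 -> pre_forward_complete_from H x0 ->
  solution_from H x0 y -> 0 <= T -> ~ escapes_at y T J.
Proof.
move=> hinner hcomplete soly T0 escy; have [_ y0] := soly.
have ymax := escaping_solution_maximal hinner soly T0 escy.
have [|ycompl] := hcomplete y (conj ymax y0).
  exact: escaping_arc_unbounded escy.
apply: ycompl; exists (Num.max T J%:R) => t j yt.
have [/=] := escaping_solution_dom hinner soly T0 escy _ yt.
rewrite in_itv /= ltnS => /andP[_ tT] jJ.
by rewrite !le_max (ltW tT) ler_nat jJ orbT.
Qed.

End Escape.

(** * Semicontinuity of the perturbed cost *)

Lemma cvg_of_dist_natSinv {R : realType} {V : normedModType R} {u : nat -> V}
    {l : V} :
  (forall i, `|u i - l| <= i.+1%:R^-1) -> u i @[i --> \oo] --> l.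
Proof.
move=> ul; apply/cvgrPdist_lt => e e0; near=> i.
rewrite distrC (le_lt_trans (ul i)) //; near: i.
exact: near_infty_natSinv_lt (PosNum e0).
Unshelve. all: by end_near. Qed.

Lemma nbhs_hybrid_point {R : realType} {n : nat} {T : R} {J : nat}
    {v : 'rV[R]_n} {d : R} :
  0 < d -> nbhs ((T, J), v)
    [set w : R * nat * 'rV[R]_n | `|w.1.1 - T| < d /\ w.1.2 = J].
Proof.
move=> d0; exists ([set p | `|p.1 - T| < d /\ p.2 = J], setT) => /=.
  split; last exact: filterT.
  exists ([set t | `|t - T| < d], [set J]) => /=; first split=> //.
    near=> t; rewrite /= distrC; near: t.
    exact: (@cvgr_dist_lt _ _ _ _ _ id T cvg_id).
  by move=> [t j] [].
by move=> [p w] [].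
Unshelve. all: by end_near. Qed.

(** Regroups a product neighbourhood so as to separate the initial state, which
    converges in state space, from the terminal point, which lies on a graph. *)
Lemma nbhs_cost_arg {R : realType} {n : nat} {x0 v : 'rV[R]_n} {p : R * nat}
    {W : set (cost_arg R n)} :
  nbhs (x0, p, v) W -> exists P, exists2 Q : set (R * nat * 'rV[R]_n),
    nbhs x0 P /\ nbhs (p, v) Q &
    forall a q w, P a -> Q (q, w) -> W (a, q, w).
Proof.
move=> [[A C] /= [[[P B] /= [nP nB] PBA] nC] ACW].
exists P, (B `*` C); first by split=> //; exists (B, C).
by move=> a q w Pa [/= Bq Cw]; apply: ACW; split=> //; exact: PBA.
Qed.

Lemma hausdorff_prod {X Y : topologicalType} :
  hausdorff_space X -> hausdorff_space Y -> hausdorff_space (X * Y)%type.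
Proof.
move=> hX hY [a b] [c d] cl; congr pair.
- apply: hX => A C nA nC.
  have [||[u v] [[/= ? _] [/= ? _]]] := cl (A `*` setT) (C `*` setT).
  + by exists (A, setT) => //; split=> //; exact: filterT.
  + by exists (C, setT) => //; split=> //; exact: filterT.
  by exists u.
- apply: hY => B D nB nD.
  have [||[u v] [[/= _ ?] [/= _ ?]]] := cl (setT `*` B) (setT `*` D).
  + by exists (setT, B) => //; split=> //; exact: filterT.
  + by exists (setT, D) => //; split=> //; exact: filterT.
  by exists v.
Qed.

Section PerturbedCost.
Context {R : realType} {n : nat} {H : hybrid_system R n} {x0 : 'rV[R]_n}
  {T : R} {J : nat} {c : cost_arg R n -> R}.

Lemma perturbed_cost_le {x : pre_arc R n} {t e : R} :
  solution H x -> arc_dom x (t, J) -> `|t - T| <= e ->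
  (perturbed_cost H c T J (x (0%R, 0%N)) e
    <= (c (x (0, 0%N), (t, J), x (t, J)))%:E)%E.
Proof.
move=> solx xt; rewrite ler_norml => /andP[? ?].
have [[[xge0 _] _] _ _ _ _] := solx; have /= t0 := xge0 _ xt.
apply: optimal_cost_le => //; split=> //=; split=> //; split=> //=.
by rewrite in_itv /= ge_max t0 /=; apply/andP; split; lra.
Qed.

Lemma perturbed_cost_lt {x0' : 'rV[R]_n} {e r : R} :
  (perturbed_cost H c T J x0' e < r%:E)%E ->
  exists x t, [/\ solution_from H x0' x, terminal_time x t J,
    compact (arc_dom x), `|t - T| <= e & c (x0', (t, J), x (t, J)) < r].
Proof.
move=> /ereal_inf_lt[q [x [t [j [[solx xcomp] xt]]]]].
move=> [/= [/= x00 [/= + jJ]] _] ->; subst j; rewrite x00 lte_fin => tT cr.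
exists x, t; split=> //.
move: tT; rewrite in_itv /= ge_max => /andP[/andP[_ ?] ?].
by rewrite ler_norml; apply/andP; split; lra.
Qed.

Lemma cost_near (v : 'rV[R]_n) {d : R} :
  (forall y, cost_continuous_at c (x0, (T, J), y)) ->
  0 < d ->
  exists P, exists2 Q : set (R * nat * 'rV[R]_n),
    nbhs x0 P /\ nbhs ((T, J), v) Q &
    forall a t j w, P a -> Q ((t, j), w) -> 0 <= t ->
      `|c (x0, (T, J), v) - c (a, (t, j), w)| < d.
Proof.
move=> hcont d0.
have /cvgrPdist_lt/(_ d d0) := hcont v.
rewrite near_withinE => /nbhs_cost_arg[P [Q nPQ PQ]].
by exists P, Q => // a t j w Pa Qw t0; exact: PQ.
Qed.

(** Take a compact solution [x] from [x0] ending at [(T, J)] whose cost exceeds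
    the infimum [r0] by less than [e / 2]. If the bound failed for initial
    states tending to [x0], inner well-posedness would give solutions from
    these states converging graphically to [x], hence passing within hybrid
    time distance [e] of [(T, J)] at states close to [x (T, J)], and by
    continuity their costs would be below [r0 + e]. The bound [e <= s] makes
    room for the shift of the terminal time; it is the reason why [x0'] must
    be much closer to [x0] than [s] is to [0]. *)
Lemma perturbed_cost_upper {r0 : R} :
  (forall y, cost_continuous_at c (x0, (T, J), y)) ->
  nominally_inner_well_posed H x0 ->
  perturbed_cost H c T J x0 0 = r0%:E ->
  forall e : R, 0 < e -> exists2 r : R, 0 < r & forall x0' (s : R), e <= s ->
    init_set H x0' -> enorm (x0' - x0) < r ->
    (perturbed_cost H c T J x0' s <= (r0 + s)%:E)%E.
Proof.
move=> hcont hinner h0 e e0; have e20 : 0 < e / 2 by lra.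
apply: contrapT => bad.
have /choice[p hp] i : exists p : 'rV[R]_n * R, [/\ e <= p.2, init_set H p.1,
    enorm (p.1 - x0) < i.+1%:R^-1 &
    ((r0 + p.2)%:E < perturbed_cost H c T J p.1 p.2)%E].
  apply: contrapT => nobad; apply: bad; exists i.+1%:R^-1 => // x0' s es x0'H d.
  by rewrite leNgt; apply/negP => lt; apply: nobad; exists (x0', s).
have cvgp : (p i).1 @[i --> \oo] --> x0.
  apply: cvg_of_dist_natSinv => i; apply: le_trans (norm_le_enorm _) _.
  by case: (hp i) => _ _ /ltW.
have [|x [t [solx xterm xcomp + cx]]] := @perturbed_cost_lt x0 0 (r0 + e / 2).
  by rewrite h0 lte_fin; lra.
rewrite normr_le0 subr_eq0 => /eqP tT; subst t.
have [[xarc _ _ _ _] x00] := solx.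
have xclosed : (arc_bounded x \/ arc_complete x) /\ closed (arc_dom x).
  split; first by left; exact: compact_arc_bounded xarc xterm.
  apply: compact_closed xcomp.
  by apply: hausdorff_prod; [exact: norm_hausdorff | exact: discrete_hausdorff].
have [||y [ysol /(_ xclosed)[_ [gy _]] _]] := hinner x solx (fun i => (p i).1).
- by move=> i; case: (hp i).
- by rewrite x00.
have [P [Q [nP nQ] PQ]] := cost_near (x (T, J)) hcont e20.
have : inner_limit (fun i => smap_graph (arc_smap (y i)))
    ((T, J), x (T, J)).
  by rewrite gy; split=> //; case: xterm.
move=> /(_ _ (filterI nQ (nbhs_hybrid_point e0))) meet.
near \oo => i.
have [[[t j] w] [[/= yt ->] [Qw [/= tT jJ]]]] :
  smap_graph (arc_smap (y i)) `&`
    (Q `&` [set w | `|w.1.1 - T| < e /\ w.1.2 = J]) !=set0 by near: i.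
have Pi : P (p i).1 by near: i; exact: cvgp.
subst j; have [es _ _] := hp i; rewrite ltNge => /negP; apply.
have [soly y0] := ysol i.
have [[[yge0 _] _] _ _ _ _] := soly.
rewrite -{1}y0; apply: le_trans (perturbed_cost_le soly yt _) _.
  by rewrite (le_trans (ltW tT)).
rewrite lee_fin y0.
have := PQ _ _ _ _ Pi Qw (yge0 _ yt).
by rewrite ltr_norml => /andP[? ?]; lra.
Unshelve. all: by end_near. Qed.

(** If cheap solutions exist with initial states tending to [x0] and terminal
    hybrid times tending to [(T, J)], a subsequence converges graphically. It is
    locally eventually bounded, since otherwise outer well-posedness would
    give a solution from [x0] escaping in finite time. Its limit is therefore
    a solution from [x0], and a cluster point of the terminal states shows
    that it passes through [(T, J)] at a cost at most [r0 - e]. *)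
Lemma perturbed_cost_lower {r0 : R} :
  (forall y, cost_continuous_at c (x0, (T, J), y)) ->
  nominally_inner_well_posed H x0 -> nominally_outer_well_posed H x0 ->
  pre_forward_complete_from H x0 -> 0 <= T ->
  (r0%:E <= perturbed_cost H c T J x0 0)%E ->
  forall e : R, 0 < e -> exists2 r : R, 0 < r & forall x0' (s : R),
    `|x0' - x0| < r -> s < r ->
    ((r0 - e)%:E <= perturbed_cost H c T J x0' s)%E.
Proof.
move=> hcont hinner houter hcomplete T0 h0 e e0; apply: contrapT => bad.
have /choice[xt hxt] i : exists xt : pre_arc R n * R,
    [/\ solution H xt.1, arc_dom xt.1 (xt.2, J), `|xt.2 - T| <= i.+1%:R^-1,
        `|xt.1 (0, 0%N) - x0| <= i.+1%:R^-1 &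
        c (xt.1 (0, 0%N), (xt.2, J), xt.1 (xt.2, J)) < r0 - e].
  apply: contrapT => nobad; apply: bad.
  exists i.+1%:R^-1 => // x0' s dx sr; rewrite leNgt; apply/negP.
  move=> /perturbed_cost_lt[x [t [[solx x00] [xt _] _ tT cx]]].
  apply: nobad; exists (x, t); split=> //=.
  - by rewrite (le_trans tT) ?ltW.
  - by rewrite x00 ltW.
  - by rewrite x00.
have [B hB] := @rational_nbhs_base R n.
have [phi [L [phi_ge phiL]]] := PK_convergent_subsequence B hB
  (fun i => smap_graph (arc_smap (xt i).1)).
pose z i := (xt (phi i)).1; pose t i := (xt (phi i)).2.
have le_phi i : (phi i).+1%:R^-1 <= i.+1%:R^-1 :> R.
  by rewrite lef_pV2 ?posrE ?ltr0n // ler_nat ltnS.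
have solz i : solution H (z i) by case: (hxt (phi i)).
have zt i : arc_dom (z i) (t i, J) by case: (hxt (phi i)).
have cvgt : t i @[i --> \oo] --> T.
  apply: (@cvg_of_dist_natSinv R R^o) => i.
  by apply: le_trans (le_phi i); case: (hxt (phi i)).
have cvgz : z i (0, 0%N) @[i --> \oo] --> x0.
  apply: cvg_of_dist_natSinv => i.
  by apply: le_trans (le_phi i); case: (hxt (phi i)).
pose N p : set 'rV[R]_n := [set v | L (p, v)].
have NL : smap_graph N = L by rewrite eqEsubset; split=> [[p v]|[p v]].
have gz : graph_converges z N by rewrite /graph_converges NL.
have [bdd unbdd] := houter z N solz gz cvgz.
have [zbdd|/unbdd[T' [J' [T'0 [y [soly _ escy]]]]]] :=
  pselect (loc_eventually_bounded z); last first.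
  exact: no_escape hinner hcomplete soly T'0 escy.
have [y [soly y00] yN] := bdd zbdd.
have [|i0 [K [Kcomp zK]]] := zbdd (T + 1 + J%:R).
  by rewrite !addr_ge0.
have t0 i : 0 <= t i.
  by have [[[zge0 _] _] _ _ _ _] := solz i; exact: zge0 _ (zt i).
have tT1 i : t i <= T + 1.
  have [_ _ tT _ _] := hxt (phi i).
  rewrite -lerBlDl (le_trans (ler_norm _)) // (le_trans tT) //.
  by rewrite invf_le1 ?ler1n.
have [|v [_ vcl]] := Kcomp (z i (t i, J) @[i --> \oo]) _.
  by exists i0 => // i i0i; apply: zK (zt i) _ => //; rewrite lerD2r.
(* A cluster point [v] of the terminal states is enough: near it the graphs
   are met at arbitrarily late indices, and the outer limit is the limit. *)
have often (U : set (R * nat * 'rV[R]_n)) k : nbhs ((T, J), v) U ->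
    exists2 i, (k <= i)%N & U ((t i, J), z i (t i, J)).
  move=> [[A V] /= [[[A1 A2] /= [nA1 nA2] A12] nV] AVU].
  have nearA : \forall i \near \oo, A1 (t i) /\ (k <= i)%N.
    by near=> i; split; near: i; [exact: cvgt | exact: nbhs_infty_ge].
  have [|w [/= [i [iA ki] iw] Vw]] :=
    vcl ((fun i => z i (t i, J)) @` [set i | A1 (t i) /\ (k <= i)%N]) V _ nV.
    by apply: filterS nearA => i hi; exists i.
  exists i => //; apply: AVU; split=> /=; last by rewrite iw.
  by apply: A12; split=> //=; exact: nbhs_singleton nA2.
have [yT vy] : arc_smap y (T, J) v.
  rewrite yN; have [_ outerL] := phiL.
  rewrite /N /= -outerL => U nU k.
  have [i ki Ui] := often U k nU.
  exists i => //; exists ((t i, J), z i (t i, J)); split; last exact: Ui.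
  by split; first exact: zt.
have [P [Q [nP nQ] PQ]] := cost_near v hcont e0.
have [k _ Pk] := cvgz _ nP.
have [i ki Qi] := often Q k nQ.
have := PQ _ _ _ _ (Pk i ki) Qi (t0 i).
have [_ _ _ _] := hxt (phi i); rewrite -/(z i) -/(t i) => ci.
rewrite ltr_norml => /andP[_ ?].
have := @perturbed_cost_le y T 0 soly yT; rewrite subrr normr0 lexx y00 -vy.
move=> /(_ isT) /(le_trans h0); rewrite lee_fin; lra.
Unshelve. all: by end_near. Qed.

End PerturbedCost.

Theorem theorem18 (R : realType) (n : nat) (H : hybrid_system R n)
    (x0 : 'rV[R]_n) (T : R) (J : nat) (c : cost_arg R n -> R)
    (hx0 : init_set H x0)
    (hinner : nominally_inner_well_posed H x0)
    (houter : nominally_outer_well_posed H x0)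
    (hcomplete : pre_forward_complete_from H x0)
    (hT : 0 <= T)
    (hreach : reachable_set H x0 T J !=set0)
    (hc : cost_function c)
    (hcont : forall y : 'rV[R]_n, cost_continuous_at c (x0, (T, J), y)) :
  exists2 alpha : R -> R, class_K alpha &
    perturbed_cost H c T J p.1 p.2
      @[p --> within [set p : 'rV[R]_n * R |
                [/\ 0 < p.2, enorm (p.1 - x0) <= alpha p.2 & init_set H p.1]]
              (nbhs (x0, 0 : R))]
      --> perturbed_cost H c T J x0 0.
Proof.
have [_ [x [[[solx _] x00] xT] _]] := hreach.
have [r0 h0] : exists r0 : R, perturbed_cost H c T J x0 0 = r0%:E.
  have h_ub := @perturbed_cost_le _ _ H T J c x T 0 solx xT.
  rewrite subrr normr0 lexx x00 in h_ub.
  exists (fine (perturbed_cost H c T J x0 0)); rewrite fineK //.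
  apply/fin_real/andP; split; last exact: le_lt_trans (h_ub isT) (ltry _).
  apply: (@lt_le_trans _ _ 0%E); first exact: ltNyr.
  apply: le_ereal_inf_tmp => _ [y [s [j [[[[[yge0 _] _] _ _ _ _] _] [ys _] _ ->]]]].
  by rewrite lee_fin; apply: hc; exact: (yge0 _ ys).
have upper := perturbed_cost_upper hcont hinner h0.
have h0le : (r0%:E <= perturbed_cost H c T J x0 0)%E by rewrite h0.
have lower := perturbed_cost_lower hcont hinner houter hcomplete hT h0le.
(* The initial states at distance [d] that violate the upper bound at [s]; the
   graph of [alpha] has to stay below them. *)
pose bad d s := exists x0', [/\ init_set H x0', d = enorm (x0' - x0) &
  ((r0 + s)%:E < perturbed_cost H c T J x0' s)%E].
have [|e e0|alpha alphaK alpha_bad] := @class_K_avoiding R bad.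
- by move=> d s [x0' [_ -> _]]; exact: sqrtr_ge0.
- have [r r_gt0 hr] := upper e e0; exists r => // d s es [x0' [x0'H -> lt]].
  by rewrite leNgt; apply: contraTN lt => /(hr _ _ es x0'H); rewrite leNgt.
exists alpha => //; rewrite h0.
have cvg1 : p.1 @[p --> nbhs (x0, 0 : R)] --> x0 by exact: cvg_fst.
have cvg2 : p.2 @[p --> nbhs (x0, 0 : R)] --> (0 : R) by exact: cvg_snd.
have p2small d : 0 < d -> \forall p \near nbhs (x0, 0 : R), p.2 < d.
  move=> d0; near=> q; rewrite -[q.2]subr0 (le_lt_trans (ler_norm _)) //.
  rewrite distrC; near: q.
  by move/cvgrPdist_lt: cvg2; apply.
have sandwich : forall e : R, 0 < e ->
    \forall p \near within [set p : 'rV[R]_n * R |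
        [/\ 0 < p.2, enorm (p.1 - x0) <= alpha p.2 & init_set H p.1]]
      (nbhs (x0, 0 : R)),
    ((r0 - e)%:E <= perturbed_cost H c T J p.1 p.2 <= (r0 + e)%:E)%E.
  move=> e e0; have [r r_gt0 hr] := lower e e0.
  rewrite near_withinE; near=> p => -[p2 palpha pH].
  have p1r : `|p.1 - x0| < r.
    rewrite distrC; near: p.
    by move/cvgrPdist_lt: cvg1; apply.
  have p2r : p.2 < r by near: p; exact: p2small.
  have p2e : p.2 < e by near: p; exact: p2small.
  have p21 : p.2 < 1 by near: p; exact: p2small.
  rewrite hr //= (@le_trans _ _ (r0 + p.2)%:E) //; last first.
    by rewrite lee_fin lerD2l ltW.
  rewrite leNgt; apply/negP => lt.
  have := alpha_bad (enorm (p.1 - x0)) _ p2 p21.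
  by rewrite ltNge palpha => /(_ (ex_intro _ p.1 (And3 pH erefl lt))).
apply/fine_cvgP; split.
  apply: filterS (sandwich 1 ltr01) => p /andP[lo hi].
  apply/fin_real/andP; split; first exact: lt_le_trans (ltNyr _) lo.
  exact: le_lt_trans hi (ltry _).
apply/cvgrPdist_le => e e0; apply: filterS (sandwich e e0) => p /=.
case: (perturbed_cost H c T J p.1 p.2) => [w| |] /=; last 2 first.
- by rewrite leye_eq andbF.
- by [].
by rewrite !lee_fin ler_norml => /andP[? ?]; apply/andP; split; lra.
Unshelve. all: by end_near. Qed.
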